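(* For every integer $r\ge2$, $$ \begin{aligned} \log\mathcal C_r\left(\frac14\right) &=\frac{\log2}{2^{2r-1}}-\frac{(r-1)!}{(2\pi)^{r-1}}\sin\left(\frac{r\pi}{2}\right)\zeta_E(r) \\ &\quad-\frac{r-1}{2^{2(r-1)}}\sum_{k=0}^{\lfloor \frac{r-2}{2}\rfloor }(-1)^k(2k)!\binom{r-2}{2k}\left(\frac2\pi\right)^{2k+1}\beta(2k+2) \\ &\quad-\frac{r-1}{2^{2r-1}}\sum_{k=1}^{\lceil \frac{r-2}2\rceil}\frac{(-1)^{k-1}(2k-1)!}{\pi^{2k}}\binom{r-2}{2k-1}\zeta_E(2k+1). \end{aligned} $$
   Context: For an integer $r\ge2$ let $P_r(y)=(1-y)\exp\left(y+\frac{y^2}{2}+\cdots+\frac{y^r}{r}\right)$. The multiple cosine function of Kurokawa–Koyama of order $r\ge2$ is $\mathcal C_r(x)=\prod_{n\ge1,\ n\text{ odd}}\left\{P_r\left(\frac{x}{n/2}\right)P_r\left(-\frac{x}{n/2}\right)^{(-1)^{r-1}}\right\}^{(n/2)^{r-1}}$, interpreted as $\mathcal C_r(x)=\exp\Big(\sum_{n\ge1,\,n\text{ odd}}(n/2)^{r-1}\big[\operatorname{Log}P_r(2x/n)+(-1)^{r-1}\operatorname{Log}P_r(-2x/n)\big]\Big)$, where $\operatorname{Log}P_r(y):=\operatorname{Log}(1-y)+y+\frac{y^2}{2}+\cdots+\frac{y^r}{r}$ with $\operatorname{Log}$ the principal branch. The series converges and defines a holomorphic function on $D=\mathbb C\setminus\big((-\infty,-\tfrac12]\cup[\tfrac12,\infty)\big)$,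 positive on $(-\tfrac12,\tfrac12)$; $\log\mathcal C_r(x)$ denotes the exponent above (the real logarithm for real $|x|<\tfrac12$). $\zeta_E(s)=\sum_{n=1}^\infty\frac{(-1)^{n+1}}{n^s}=(1-2^{1-s})\zeta(s)$, $\beta(s)=\sum_{n=0}^\infty\frac{(-1)^n}{(2n+1)^s}$. Empty sums are $0$. *)

(* Defs.v *)
From Stdlib Require Import Reals.
From Coquelicot Require Import Coquelicot.
Open Scope R_scope.

(* Log P_r(y) = Log(1-y) + y + y^2/2 + ... + y^r/r  (real version; used only
   for real y < 1, where the principal Log is the real ln). *)
Definition LogP (r : nat) (y : R) : R :=
  ln (1 - y) + sum_n_m (fun j => y ^ j / INR j) 1 r.

(* log C_r(x) = sum over odd n of (n/2)^(r-1) [LogP_r(2x/n) + (-1)^(r-1) LogP_r(-2x/n)],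
   indexed by n = 2m+1, m >= 0; for real |x| < 1/2. *)
Definition logC (r : nat) (x : R) : R :=
  Series (fun m : nat =>
    let n := INR (2 * m + 1) in
    (n / 2) ^ (r - 1) *
      (LogP r (2 * x / n) + (-1) ^ (r - 1) * LogP r (- (2 * x) / n))).

Definition zetaE (s : nat) : R :=
  Series (fun n : nat => (-1) ^ n / INR (n + 1) ^ s).

Definition beta (s : nat) : R :=
  Series (fun n : nat => (-1) ^ n / INR (2 * n + 1) ^ s).

(* Main.v *)
(* Write p = r - 1 and let n run over the odd integers.  The n-th term of the
   series for log C_r has derivative - x^p * 8x / (n^2 - 4x^2), so the partial
   fraction expansion of pi * tan (pi x) gives
   log C_r (1/4) = - int_0^{1/4} pi t^p tan (pi t) dt.  The expansion is used in
   integrated form, as the product cos (pi x) = prod (1 - 4x^2/n^2): the integrals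
   I_n(x) = int_0^{pi/2} (cos u)^n cos (2xu) du satisfy
   (n^2 - 4x^2) I_n(x) = n (n-1) I_{n-2}(x), and I_n(x) / I_n(0) tends to 1
   uniformly in x.
   On the other side 2 sum_{k <= N} (-1)^(k+1) sin (2 pi k t) differs from
   tan (pi t) by an oscillating term that integrates to o(1) against t^p, and
   each int_0^{1/4} t^p sin (2 pi k t) dt is elementary; summing over k produces
   zeta_E and beta.  The case p = 0 yields zeta_E(1) = log 2. *)
Require Import Defs.
From Stdlib Require Import Reals Factorial Lra Lia.
From Coquelicot Require Import Coquelicot.
Open Scope R_scope.

(* [sum_n] takes values in the carrier of [R_AbelianMonoid], which [ring] does not see as [R]. *)
Ltac eqR := match goal with |- @eq _ ?a ?b => change (@eq R a b) end.

(** * Finite sums, series and integrals *)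

Lemma sum_n_succ (u : nat -> R) (n : nat) : sum_n u (S n) = sum_n u n + u (S n).
Proof. exact (sum_Sn u n). Qed.

Lemma sum_n_scal_minus (c : R) (u v : nat -> R) (n : nat) :
  sum_n (fun k => c * u k - c * v k) n = c * (sum_n u n - sum_n v n).
Proof.
  induction n as [|n IH].
  - rewrite !sum_O. eqR. ring.
  - rewrite !sum_n_succ, IH. eqR. ring.
Qed.

Lemma sum_n_Rmult (c : R) (u : nat -> R) (n : nat) :
  sum_n (fun k => c * u k) n = c * sum_n u n.
Proof. exact (sum_n_mult_l (K := R_AbsRing) c u n). Qed.

Lemma sum_n_succ_l (u : nat -> R) (n : nat) :
  sum_n u (S n) = u O + sum_n (fun k => u (S k)) n.
Proof.
  unfold sum_n. rewrite sum_Sn_m by lia. now rewrite <- (sum_n_m_S u).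
Qed.

Lemma sum_n_m_Rmult (c : R) (u : nat -> R) (n m : nat) :
  sum_n_m (fun k => c * u k) n m = c * sum_n_m u n m.
Proof. exact (sum_n_m_mult_l (K := R_AbsRing) c u n m). Qed.

(** Serves to sort the terms of [tanI_closed_form]: there the parity of the index decides whether
    [beta] or [zetaE] survives, and index 0 stands apart because it gives the logarithm. With p = r
    - 2, the bound [S p / 2] is the ceiling of (r-2)/2. *)
Lemma sum_n_parity_split (u : nat -> R) (p : nat) :
  sum_n u (S p) = u O + sum_n_m (fun k => u (2 * k + 1)%nat) 0 (p / 2)
                  + sum_n_m (fun k => u (2 * k)%nat) 1 (S p / 2).
Proof.
  (* Both parities of the upper limit are treated with explicit bounds in q, so the integer
     divisions are evaluated only at the end. *)
  assert (H : forall q,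
    sum_n u (2 * q + 1) = u O + sum_n_m (fun k => u (2 * k + 1)%nat) 0 q
                              + sum_n_m (fun k => u (2 * k)%nat) 1 q
    /\ sum_n u (2 * q + 2) = u O + sum_n_m (fun k => u (2 * k + 1)%nat) 0 q
                              + sum_n_m (fun k => u (2 * k)%nat) 1 (S q)).
  { intros q.
    assert (A : sum_n u (2 * q + 1) = u O + sum_n_m (fun k => u (2 * k + 1)%nat) 0 q
                              + sum_n_m (fun k => u (2 * k)%nat) 1 q).
    { induction q as [|q IH].
      - rewrite sum_n_n, sum_n_m_zero by lia. change (2 * 0 + 1)%nat with 1%nat.
        rewrite sum_n_succ, sum_O. change zero with 0. eqR. ring.
      - replace (2 * S q + 1)%nat with (S (S (2 * q + 1))) by lia.
        rewrite !sum_n_succ, IH. rewrite (sum_n_Sm _ 0 q), (sum_n_Sm _ 1 q) by lia.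
        change (plus ?a ?b) with (Rplus a b).
        replace (2 * S q + 1)%nat with (S (S (2 * q + 1))) by lia.
        replace (2 * S q)%nat with (S (2 * q + 1)) by lia. eqR. ring. }
    split; [exact A|].
    replace (2 * q + 2)%nat with (S (2 * q + 1)) by lia.
    rewrite sum_n_succ, A. rewrite (sum_n_Sm _ 1 q) by lia.
    change (plus ?a ?b) with (Rplus a b).
    replace (2 * S q)%nat with (S (2 * q + 1)) by lia. eqR. ring. }
  destruct (Nat.Even_or_Odd p) as [[q ->]|[q ->]].
  - replace (2 * q / 2)%nat with q by (rewrite Nat.mul_comm, Nat.div_mul; lia).
    replace (S (2 * q) / 2)%nat with q.
    + replace (S (2 * q)) with (2 * q + 1)%nat by lia. apply H.
    + apply (Nat.div_unique _ _ q 1); lia.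
  - replace ((2 * q + 1) / 2)%nat with q by (apply (Nat.div_unique _ _ q 1); lia).
    replace (S (2 * q + 1) / 2)%nat with (S q) by (apply (Nat.div_unique _ _ (S q) 0); lia).
    replace (S (2 * q + 1)) with (2 * q + 2)%nat by lia. apply H.
Qed.

Lemma is_series_Rmult (c : R) (a : nat -> R) (l : R) :
  is_series a l -> is_series (fun n => c * a n) (c * l).
Proof. exact (is_series_scal (V := R_NormedModule) c a l). Qed.

Lemma is_series_sum_n (a : nat -> nat -> R) (l : nat -> R) (n : nat) :
  (forall k, is_series (a k) (l k)) ->
  is_series (fun m => sum_n (fun k => a k m) n) (sum_n l n).
Proof.
  intros H. induction n as [|n IH].
  - rewrite sum_O. apply (is_series_ext (a O)); [|apply H].
    intros m. now rewrite sum_O.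
  - rewrite sum_n_succ.
    apply (is_series_ext (fun m => plus (sum_n (fun k => a k m) n) (a (S n) m))).
    + intros m. now rewrite sum_n_succ.
    + now apply (is_series_plus (V := R_NormedModule)).
Qed.

Lemma is_lim_seq_inv_succ : is_lim_seq (fun n => / INR (S n)) 0.
Proof.
  apply (is_lim_seq_incr_1 (fun n => / INR n)).
  replace (Finite 0) with (Rbar_inv p_infty) by reflexivity.
  apply is_lim_seq_inv; [apply is_lim_seq_INR|easy].
Qed.

Lemma is_RInt_derivative (F f : R -> R) (a b : R) :
  (forall x, Rmin a b <= x <= Rmax a b -> is_derive F x (f x)) ->
  (forall x, Rmin a b <= x <= Rmax a b -> ex_derive f x) ->
  is_RInt f a b (F b - F a).
Proof.
  intros HF Hf. apply (is_RInt_derive (V := R_CompleteNormedModule) F f); [exact HF|].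
  intros x Hx. now apply (ex_derive_continuous f), Hf.
Qed.

Lemma is_RInt_lincomb (f g : R -> R) (c d a b : R) :
  ex_RInt f a b -> ex_RInt g a b ->
  is_RInt (fun x => c * f x - d * g x) a b (c * RInt f a b - d * RInt g a b).
Proof.
  intros Hf Hg.
  apply (is_RInt_minus (V := R_NormedModule) (fun x => c * f x) (fun x => d * g x));
    apply (is_RInt_scal (V := R_NormedModule)), (RInt_correct (V := R_CompleteNormedModule));
    assumption.
Qed.

Lemma is_RInt_sum_n (f : nat -> R -> R) (I : nat -> R) (a b : R) (n : nat) :
  (forall k, is_RInt (f k) a b (I k)) ->
  is_RInt (fun t => sum_n (fun k => f k t) n) a b (sum_n I n).
Proof.
  intros H. induction n as [|n IH].
  - rewrite sum_O. apply (is_RInt_ext (f O)); [|apply H].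
    intros t _. now rewrite sum_O.
  - rewrite sum_n_succ.
    apply (is_RInt_ext (fun t => plus (sum_n (fun k => f k t) n) (f (S n) t))).
    + intros t _. now rewrite sum_n_succ.
    + now apply (is_RInt_plus (V := R_NormedModule)).
Qed.

(** * The cosine product *)

Definition cosI (n : nat) (x : R) : R :=
  RInt (fun u => cos u ^ n * cos (2 * x * u)) 0 (PI / 2).

Lemma ex_RInt_cosI (n : nat) (x a b : R) :
  ex_RInt (fun u => cos u ^ n * cos (2 * x * u)) a b.
Proof.
  apply (ex_RInt_continuous (V := R_CompleteNormedModule)); intros u _.
  apply (ex_derive_continuous (fun u => cos u ^ n * cos (2 * x * u))).
  now auto_derive.
Qed.

(** Two integrations by parts. The boundary term at pi/2 contains (cos (pi/2))^k = 0^k, which is 1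
    only for k = 0 and so starts the recursion; there the truncated [pred k] is harmless because of
    the factor [INR k]. *)
Lemma cosI_rec (k : nat) (x : R) :
  (INR (S k) ^ 2 - 4 * x ^ 2) * cosI (S k) x
  = INR (S k) * 0 ^ k * cos (PI * x) + INR (S k) * INR k * cosI (pred k) x.
Proof.
  (* [F] collects the boundary terms of the two integrations by parts, and [f] is its derivative
     once sin^2 is replaced by 1 - cos^2. *)
  pose (F := fun u => INR (S k) * cos u ^ k * sin u * cos (2 * x * u)
                      - 2 * x * cos u ^ (S k) * sin (2 * x * u)).
  pose (f := fun u => (INR (S k) ^ 2 - 4 * x ^ 2) * (cos u ^ (S k) * cos (2 * x * u))
                      - INR (S k) * INR k * (cos u ^ pred k * cos (2 * x * u))).
  assert (H : is_RInt f 0 (PI / 2) (F (PI / 2) - F 0)).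
  { apply is_RInt_derivative.
    - intros u _. unfold F, f. auto_derive; [easy|].
      assert (Hs : sin u * sin u = 1 - cos u * cos u)
        by (pose proof (sin2_cos2 u) as Hsc; unfold Rsqr in Hsc; lra).
      destruct k as [|k]; simpl pred.
      + simpl. ring [Hs].
      + rewrite !S_INR. simpl. rewrite ?S_INR. ring [Hs].
    - intros u _. unfold f. now auto_derive. }
  pose proof (is_RInt_lincomb _ _ (INR (S k) ^ 2 - 4 * x ^ 2) (INR (S k) * INR k) _ _
    (ex_RInt_cosI (S k) x 0 (PI / 2)) (ex_RInt_cosI (pred k) x 0 (PI / 2))) as H'.
  apply (is_RInt_unique (V := R_CompleteNormedModule)) in H, H'.
  unfold f in H. rewrite H in H'. clear H. rename H' into H.
  fold (cosI (S k) x) in H. fold (cosI (pred k) x) in H.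
  unfold F in H.
  rewrite cos_PI2, sin_PI2, Rmult_0_r, sin_0 in H.
  replace (2 * x * (PI / 2)) with (PI * x) in H by field.
  simpl in *. lra.
Qed.

Lemma cosI_0_pos (n : nat) : 0 < cosI n 0.
Proof.
  pose proof PI_RGT_0.
  apply RInt_gt_0; [lra| |].
  - intros u Hu. rewrite Rmult_0_r, Rmult_0_l, cos_0, Rmult_1_r.
    apply pow_lt, cos_gt_0; lra.
  - intros u _. apply continuity_pt_filterlim.
    apply derivable_continuous_pt. apply ex_derive_Reals_0. now auto_derive.
Qed.

Definition ln_cos_prod (m : nat) (x : R) : R :=
  sum_n (fun k => ln (1 - 4 * x ^ 2 / INR (2 * k + 1) ^ 2)) m.

Lemma odd_factor_pos (k : nat) (x : R) :
  Rabs x < 1 / 2 -> 0 < 1 - 4 * x ^ 2 / INR (2 * k + 1) ^ 2.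
Proof.
  intros Hx.
  assert (H1 : 1 <= INR (2 * k + 1)) by (apply (le_INR 1); lia).
  assert (Hx2 : x ^ 2 < 1 / 4).
  { rewrite <- (pow2_abs x). pose proof (Rabs_pos x). nra. }
  assert (4 * x ^ 2 / INR (2 * k + 1) ^ 2 < 1); [|lra].
  apply Rmult_lt_reg_r with (INR (2 * k + 1) ^ 2); [nra|].
  unfold Rdiv. rewrite Rmult_assoc, Rinv_l; nra.
Qed.

(** Dividing the recurrence at x by the one at 0 cancels n(n-1)/n^2 and leaves the factor 1 -
    4x^2/n^2; the base n = 1 supplies cos (pi x). The error of the finite product is thus exactly
    the ratio I_n(x)/I_n(0) with n = 2m+1. *)
Lemma cosI_cos_prod (m : nat) (x : R) :
  Rabs x < 1 / 2 ->
  cosI (2 * m + 1) x * exp (ln_cos_prod m x) = cos (PI * x) * cosI (2 * m + 1) 0.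
Proof.
  intros Hx. unfold ln_cos_prod. induction m as [|m IH].
  - rewrite sum_O, exp_ln by now apply odd_factor_pos.
    change (2 * 0 + 1)%nat with 1%nat.
    pose proof (cosI_rec 0 x) as H1. pose proof (cosI_rec 0 0) as H2.
    rewrite Rmult_0_r, cos_0 in H2. simpl in *.
    replace (cosI 1 0) with 1 by lra. lra.
  - rewrite sum_n_succ.
    rewrite exp_plus, exp_ln by now apply odd_factor_pos.
    pose proof (cosI_rec (2 * m + 2) x) as H1. pose proof (cosI_rec (2 * m + 2) 0) as H2.
    replace (S (2 * m + 2)) with (2 * S m + 1)%nat in * by lia.
    replace (pred (2 * m + 2)) with (2 * m + 1)%nat in * by lia.
    rewrite (pow_i (2 * m + 2)) in H1, H2 by lia.
    set (n := INR (2 * S m + 1)) in *.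
    assert (Hn : 0 < n) by (apply lt_0_INR; lia).
    assert (Hk : 0 < INR (2 * m + 2)) by (apply lt_0_INR; lia).
    set (k := INR (2 * m + 2)) in *.
    assert (E1 : (1 - 4 * x ^ 2 / n ^ 2) * cosI (2 * S m + 1) x = k / n * cosI (2 * m + 1) x).
    { apply Rmult_eq_reg_l with (n ^ 2); [|nra].
      transitivity ((n ^ 2 - 4 * x ^ 2) * cosI (2 * S m + 1) x); [field; lra|].
      rewrite H1. field; lra. }
    assert (E2 : cosI (2 * S m + 1) 0 = k / n * cosI (2 * m + 1) 0).
    { apply Rmult_eq_reg_l with (n ^ 2); [|nra].
      transitivity ((n ^ 2 - 4 * 0 ^ 2) * cosI (2 * S m + 1) 0); [field; lra|].
      rewrite H2. field; lra. }
    rewrite E2.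
    transitivity ((1 - 4 * x ^ 2 / n ^ 2) * cosI (2 * S m + 1) x
      * exp (sum_n (fun k => ln (1 - 4 * x ^ 2 / INR (2 * k + 1) ^ 2)) m)); [ring|].
    rewrite E1. rewrite Rmult_assoc, IH. ring.
Qed.

(** The function sin v - v cos v vanishes at 0 and has derivative v sin v, which is nonnegative
    here. Unlike u <= tan u, this form makes sense at pi/2. *)
Lemma x_cos_le_sin (u : R) : 0 <= u <= PI / 2 -> u * cos u <= sin u.
Proof.
  intros [H0 H1]. pose proof PI_RGT_0.
  destruct (MVT_gen (fun v => sin v - v * cos v) 0 u (fun v => v * sin v)) as [c [Hc E]].
  - intros v _. auto_derive; [easy|ring].
  - intros v _. apply continuity_pt_filterlim.
    apply (ex_derive_continuous (fun v => sin v - v * cos v)). now auto_derive.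
  - rewrite Rmin_left, Rmax_right in Hc by lra. rewrite sin_0 in E.
    assert (0 <= sin c) by (apply sin_ge_0; lra).
    assert (0 <= c * sin c * (u - 0)) by (repeat apply Rmult_le_pos; lra).
    lra.
Qed.

(** From 1 - cos y = 2 sin^2 (y/2) and |sin z| <= |z|. *)
Lemma one_minus_cos_le (y : R) : 1 - cos y <= y ^ 2 / 2.
Proof.
  replace y with (2 * (y / 2)) at 1 by field.
  rewrite cos_2a_sin.
  assert (Rabs (sin (y / 2)) <= Rabs (y / 2)).
  { destruct (MVT_gen sin 0 (y / 2) cos) as [c [_ E]].
    - intros; auto_derive; [easy|ring].
    - intros; apply continuity_sin.
    - rewrite sin_0, !Rminus_0_r in E. rewrite E, Rabs_mult.
      pose proof (Rabs_pos (y / 2)).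
      assert (Rabs (cos c) <= 1) by (apply Rabs_le, COS_bound). nra. }
  apply Rsqr_le_abs_1 in H. unfold Rsqr in H. lra.
Qed.

Lemma cosI_le (m : nat) (x : R) : cosI m x <= cosI m 0.
Proof.
  pose proof PI_RGT_0.
  apply RInt_le; [lra|apply ex_RInt_cosI|apply ex_RInt_cosI|].
  intros u Hu. rewrite (Rmult_0_r 2), Rmult_0_l, cos_0.
  apply Rmult_le_compat_l; [apply pow_le, cos_ge_0; lra|apply COS_bound].
Qed.

(* Integrates 1 - cos (2xu) <= 2 x^2 u^2 and u^2 (cos u)^2 <= 1 - (cos u)^2 against (cos u)^m. *)
Lemma cosI_ge (m : nat) (x : R) :
  (1 - 2 * x ^ 2 / INR (S m)) * cosI (S (S m)) 0 <= cosI (S (S m)) x.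
Proof.
  pose proof PI_RGT_0.
  assert (Hm : 0 < INR (S m)) by (apply lt_0_INR; lia).
  (* The recurrence at x = 0 brings both integrals in [L] to the same index. *)
  assert (E : cosI m 0 = (1 + / INR (S m)) * cosI (S (S m)) 0).
  { pose proof (cosI_rec (S m) 0) as H1. simpl pred in H1. rewrite (pow_i (S m)) in H1 by lia.
    rewrite (S_INR (S m)) in H1.
    apply Rmult_eq_reg_l with ((INR (S m) + 1) * INR (S m)); [|nra].
    transitivity ((INR (S m) + 1) * 0 * cos (PI * 0) + (INR (S m) + 1) * INR (S m) * cosI m 0);
      [ring|rewrite <- H1; field; lra]. }
  assert (L : (1 + 2 * x ^ 2) * cosI (S (S m)) 0 - 2 * x ^ 2 * cosI m 0 <= cosI (S (S m)) x).
  { pose proof (is_RInt_lincomb _ _ (1 + 2 * x ^ 2) (2 * x ^ 2) _ _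
      (ex_RInt_cosI (S (S m)) 0 0 (PI / 2)) (ex_RInt_cosI m 0 0 (PI / 2))) as H'.
    eapply is_RInt_le; [|exact H'|apply (RInt_correct (V := R_CompleteNormedModule)), ex_RInt_cosI|].
    - lra.
    - intros u Hu.
      rewrite (Rmult_0_r 2), !Rmult_0_l, cos_0.
      set (c := cos u).
      assert (Hc : 0 <= c ^ m) by (apply pow_le, cos_ge_0; lra).
      pose proof (one_minus_cos_le (2 * x * u)) as H1.
      assert (H2 : u * c <= sin u) by (apply x_cos_le_sin; lra).
      assert (H3 : 0 <= c) by (apply cos_ge_0; lra).
      pose proof (sin2_cos2 u) as H4. unfold Rsqr in H4. fold c in H4.
      assert (H5 : (u * c) ^ 2 <= 1 - c * c).
      { assert (0 <= u * c) by nra. nra. }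
      (* [H8] is the difference of the two integrands divided by c^m: [H6] trades 1 - cos (2xu) for
         2x^2u^2, and [H7] trades (uc)^2 for 1 - c^2. *)
      assert (H6 : 0 <= c * c * (cos (2 * x * u) - 1 + (2 * x * u) ^ 2 / 2)) by (apply Rmult_le_pos; nra).
      assert (H7 : 0 <= x ^ 2 * (1 - c * c - (u * c) ^ 2)) by (apply Rmult_le_pos; nra).
      assert (H8 : 0 <= c * c * (cos (2 * x * u) - 1) + 2 * (x ^ 2 * (1 - c * c))) by nra.
      pose proof (Rmult_le_pos _ _ Hc H8) as H9.
      match goal with |- ?l <= ?r =>
        enough (r - l = c ^ m * (c * c * (cos (2 * x * u) - 1) + 2 * (x ^ 2 * (1 - c * c)))) by lra
      end.
      change (c ^ S (S m)) with (c * (c * c ^ m)). ring. }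
  rewrite E in L.
  replace ((1 - 2 * x ^ 2 / INR (S m)) * cosI (S (S m)) 0)
    with ((1 + 2 * x ^ 2) * cosI (S (S m)) 0 -
      2 * x ^ 2 * ((1 + / INR (S m)) * cosI (S (S m)) 0)) by (field; lra).
  exact L.
Qed.

(** By [cosI_cos_prod] the error is the logarithm of A/B = I_n(x)/I_n(0) with n = 2m+3. Writing i =
    1/(m+1), the two integral bounds place A/B between 1 - i/16 and 1, where 1/16 bounds x^2. Only
    uniformity in x and decay in m matter later. *)
Lemma ln_cos_prod_bound (m : nat) (x : R) :
  Rabs x <= 1 / 4 ->
  Rabs (ln (cos (PI * x)) - ln_cos_prod (S m) x) <= / INR (S m).
Proof.
  intros Hx. pose proof PI_RGT_0.
  assert (Hc : 0 < cos (PI * x)).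
  { apply Rabs_le_between in Hx. apply cos_gt_0; nra. }
  pose proof (cosI_cos_prod (S m) x ltac:(lra)) as E.
  replace (2 * S m + 1)%nat with (S (S (2 * m + 1))) in E by lia.
  pose proof (cosI_le (S (S (2 * m + 1))) x) as L1.
  pose proof (cosI_ge (2 * m + 1) x) as L2.
  pose proof (cosI_0_pos (S (S (2 * m + 1)))) as P.
  set (A := cosI (S (S (2 * m + 1))) x) in *. set (B := cosI (S (S (2 * m + 1))) 0) in *.
  assert (Hm : 1 <= INR (S m)) by (apply (le_INR 1); lia).
  replace (INR (S (2 * m + 1))) with (2 * INR (S m)) in L2
    by (rewrite !S_INR, plus_INR, mult_INR; simpl; ring).
  assert (Hx2 : x ^ 2 <= 1 / 16).
  { rewrite <- (pow2_abs x). pose proof (Rabs_pos x). nra. }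
  set (i := / INR (S m)) in *.
  assert (Hi : 0 < i <= 1).
  { split; [apply Rinv_0_lt_compat; lra|]. unfold i. rewrite <- Rinv_1. apply Rinv_le_contravar; lra. }
  replace (2 * x ^ 2 / (2 * INR (S m))) with (x ^ 2 * i) in L2 by (unfold i; field; lra).
  assert (HA : (1 - i / 16) * B <= A).
  { eapply Rle_trans; [|exact L2]. apply Rmult_le_compat_r; nra. }
  assert (A0 : 0 < A) by nra.
  assert (E' : ln (cos (PI * x)) - ln_cos_prod (S m) x = ln (A / B)).
  { replace (cos (PI * x)) with (A / B * exp (ln_cos_prod (S m) x)).
    - rewrite ln_mult, ln_exp; [ring|now apply Rdiv_lt_0_compat|apply exp_pos].
    - apply Rmult_eq_reg_r with B; [|lra]. rewrite <- E. field. lra. }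
  rewrite E'.
  assert (H1 : ln (A / B) <= 0).
  { rewrite <- ln_1. apply ln_le; [now apply Rdiv_lt_0_compat|].
    apply Rmult_le_reg_r with B; [lra|]. unfold Rdiv; rewrite Rmult_assoc, Rinv_l; lra. }
  rewrite Rabs_left1 by easy.
  rewrite <- ln_Rinv by now apply Rdiv_lt_0_compat.
  rewrite Rinv_div.
  eapply Rle_trans; [apply (ln_le _ (1 + i))|].
  - now apply Rdiv_lt_0_compat.
  - apply Rmult_le_reg_r with A; [lra|]. unfold Rdiv; rewrite Rmult_assoc, Rinv_l by lra.
    (* Since (1 + i)(1 - i/16) = 1 + i(15 - i)/16, this gives B <= (1 + i) A; then 1 + i <= exp i
       finishes. *)
    assert (H2 : 0 <= i * (15 - i)) by (apply Rmult_le_pos; lra).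
    assert (H3 : (1 + i) * ((1 - i / 16) * B) <= (1 + i) * A) by (apply Rmult_le_compat_l; lra).
    assert (H4 : 0 <= i * (15 - i) * B) by (apply Rmult_le_pos; lra).
    lra.
  - rewrite <- (ln_exp i) at 2. apply ln_le; [lra|apply exp_ineq1_le].
Qed.

(** * The tangent integral as a series *)

(** Leibniz criterion, covering [zetaE] with c = 1 and [beta] with c = 2; convergence is only
    conditional at s = 1. *)
Lemma ex_series_alternating (c s : nat) :
  (1 <= c)%nat -> (1 <= s)%nat -> ex_series (fun n => (-1) ^ n / INR (c * n + 1) ^ s).
Proof.
  intros Hc Hs. set (u := fun n => / INR (c * n + 1) ^ s).
  assert (Hpos : forall n, 0 < INR (c * n + 1)) by (intros n; apply lt_0_INR; lia).
  assert (Hdec : Un_decreasing u).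
  { intros n. apply Rinv_le_contravar; [now apply pow_lt|].
    apply pow_incr. split; [now apply Rlt_le|]. apply le_INR; nia. }
  assert (Hlim : Un_cv u 0).
  { apply is_lim_seq_Reals.
    apply is_lim_seq_le_le with (fun _ => 0) (fun n => / INR (S n)).
    - intros n. split; [now apply Rlt_le, Rinv_0_lt_compat, pow_lt|].
      apply Rinv_le_contravar; [apply lt_0_INR; lia|].
      apply Rle_trans with (INR (c * n + 1)); [apply le_INR; nia|].
      rewrite <- (pow_1 (INR _)) at 1. apply Rle_pow; [|lia].
      apply (le_INR 1); lia.
    - apply is_lim_seq_const.
    - apply is_lim_seq_inv_succ. }
  destruct (alternated_series u Hdec Hlim) as [l Hl].
  exists l. apply is_series_Reals. exact Hl.
Qed.

Lemma is_series_zetaE (s : nat) :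
  (1 <= s)%nat -> is_series (fun n => (-1) ^ n / INR (n + 1) ^ s) (zetaE s).
Proof.
  intros Hs. apply Series_correct.
  apply ex_series_ext with (2 := ex_series_alternating 1 s (le_n 1) Hs).
  intros n. now rewrite Nat.mul_1_l.
Qed.

Lemma is_series_beta (s : nat) :
  (1 <= s)%nat -> is_series (fun n => (-1) ^ n / INR (2 * n + 1) ^ s) (beta s).
Proof. intros Hs. apply Series_correct, ex_series_alternating; lia. Qed.

(** The partial sums are the subsequence at 2M+1 of those of [zetaE]. The grouping matches that of
    [is_series_tanI_moments]. *)
Lemma is_series_zetaE_pairs (s : nat) :
  (1 <= s)%nat ->
  is_series (fun m => / INR (2 * m + 1) ^ s - / INR (2 * m + 2) ^ s) (zetaE s).
Proof.
  intros Hs. pose proof (is_series_zetaE s Hs) as H.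
  assert (E : forall M, sum_n (fun m => / INR (2 * m + 1) ^ s - / INR (2 * m + 2) ^ s) M
    = sum_n (fun n => (-1) ^ n / INR (n + 1) ^ s) (2 * M + 1)).
  { assert (Hp : forall k, (-1) ^ (2 * k) = 1) by (intros k; rewrite pow_mult; replace ((-1) ^ 2) with 1 by ring; apply pow1).
    induction M as [|M IH].
    - change (2 * 0 + 1)%nat with 1%nat. rewrite sum_n_succ, !sum_O. simpl. eqR.
      field. simpl; split; apply pow_nonzero; lra.
    - rewrite sum_n_succ, IH. replace (2 * S M + 1)%nat with (S (S (2 * M + 1))) by lia.
      rewrite !sum_n_succ.
      replace (S (2 * M + 1)) with (2 * S M)%nat by lia.
      replace (S (2 * S M)) with (2 * S M + 1)%nat by lia.
      rewrite (pow_add _ (2 * S M)), Hp.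
      replace (2 * S M + 1 + 1)%nat with (2 * S M + 2)%nat by lia.
      eqR. unfold Rdiv. ring. }
  change (is_lim_seq (sum_n (fun m => / INR (2 * m + 1) ^ s - / INR (2 * m + 2) ^ s)) (zetaE s)).
  apply is_lim_seq_ext with (fun M => sum_n (fun n => (-1) ^ n / INR (n + 1) ^ s) (2 * M + 1));
    [now symmetry|].
  apply (is_lim_seq_subseq (sum_n (fun n => (-1) ^ n / INR (n + 1) ^ s)) _ (fun M => 2 * M + 1)%nat).
  - apply eventually_subseq. intros n; lia.
  - exact H.
Qed.

(** Repeated integration by parts in closed form. Each step lowers the power and shifts the phase by
    pi/2, so the induction needs [phi] general. *)
Lemma is_derive_pow_cos (p : nat) (w phi t : R) :
  w <> 0 ->
  is_derive (fun t => sum_n (fun j => INR (fact p) / INR (fact (p - j)) / w ^ S j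
               * t ^ (p - j) * cos (w * t + phi + INR j * (PI / 2))) p)
    t (- (t ^ p * sin (w * t + phi))).
Proof.
  intros Hw. revert phi. induction p as [|p IH]; intros phi.
  - apply is_derive_ext with (fun t => / w * cos (w * t + phi)).
    + intros x. rewrite sum_O. simpl. rewrite Rmult_0_l, Rplus_0_r. field. exact Hw.
    + auto_derive; [easy|]. simpl. field. exact Hw.
  (* The term j = 0 is split off; the rest is (p+1)/w times the sum for p at phase phi + pi/2. *)
  - apply is_derive_ext with (fun t =>
      / w * (t ^ S p * cos (w * t + phi)) +
      INR (S p) / w * sum_n (fun j => INR (fact p) / INR (fact (p - j)) / w ^ S j
               * t ^ (p - j) * cos (w * t + (phi + PI / 2) + INR j * (PI / 2))) p).
    + intros x. rewrite sum_n_succ_l. f_equal.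
      * rewrite Nat.sub_0_r. change (INR 0) with 0. rewrite Rmult_0_l, Rplus_0_r.
        rewrite pow_1. field. split; [apply INR_fact_neq_0|exact Hw].
      * rewrite <- sum_n_Rmult. apply sum_n_ext. intros j.
        change (S p - S j)%nat with (p - j)%nat.
        replace (w * x + phi + INR (S j) * (PI / 2))
          with (w * x + (phi + PI / 2) + INR j * (PI / 2)) by (rewrite S_INR; ring).
        rewrite fact_simpl, mult_INR. change (w ^ S (S j)) with (w * w ^ S j).
        eqR. field. repeat split; [apply INR_fact_neq_0|now apply pow_nonzero|exact Hw].
    + evar_last.
      * apply (is_derive_plus (V := R_NormedModule)).
        -- auto_derive; [easy|reflexivity].
        -- apply is_derive_scal, IH.
      * unfold plus, scal, mult; simpl. unfold mult; simpl.
        (* The shifted sine is cos (w t + phi), so the induction hypothesis cancels the term from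
           differentiating t^(p+1). *)
        replace (w * t + (phi + PI / 2)) with ((PI / 2 + (w * t + phi))) by ring.
        rewrite <- (cos_sin (w * t + phi)). destruct p; simpl; field; exact Hw.
Qed.

Lemma is_RInt_pow_sin (p : nat) (w b : R) :
  w <> 0 ->
  is_RInt (fun t => t ^ p * sin (w * t)) 0 b
    (INR (fact p) / w ^ S p * cos (INR p * (PI / 2))
     - sum_n (fun j => INR (fact p) / INR (fact (p - j)) / w ^ S j
               * b ^ (p - j) * cos (w * b + INR j * (PI / 2))) p).
Proof.
  intros Hw.
  pose (F := fun t => - sum_n (fun j => INR (fact p) / INR (fact (p - j)) / w ^ S j
               * t ^ (p - j) * cos (w * t + 0 + INR j * (PI / 2))) p).
  evar_last.
  - apply (is_RInt_derivative F).
    + intros t _. evar_last.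
      * apply (is_derive_opp (V := R_NormedModule)). now apply is_derive_pow_cos.
      * unfold opp; simpl. rewrite Rplus_0_r. ring.
    + intros t _. now auto_derive.
  - unfold F.
    (* At the endpoint 0 only j = p survives, through 0^0 = 1. *)
    assert (E0 : sum_n (fun j => INR (fact p) / INR (fact (p - j)) / w ^ S j
               * 0 ^ (p - j) * cos (w * 0 + 0 + INR j * (PI / 2))) p
             = INR (fact p) / w ^ S p * cos (INR p * (PI / 2))).
    { rewrite Rmult_0_r, !Rplus_0_l.
      destruct p as [|p].
      - rewrite sum_O. eqR. simpl. rewrite ?Rplus_0_l. field. exact Hw.
      - rewrite sum_n_succ.
        rewrite (sum_n_ext_loc _ (fun _ => 0)).
        + rewrite sum_n_const, Rmult_0_r, Rplus_0_l, Nat.sub_diag, !Rplus_0_l. simpl (INR (fact 0)). simpl (0 ^ 0).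
          eqR. field. now apply pow_nonzero.
        + intros j Hj. rewrite pow_i by lia. eqR. ring. }
    rewrite E0.
    rewrite (sum_n_ext _ (fun j => INR (fact p) / INR (fact (p - j)) / w ^ S j
               * b ^ (p - j) * cos (w * b + INR j * (PI / 2)))).
    + ring.
    + intros j. now rewrite Rplus_0_r.
Qed.

(* Riemann-Lebesgue for a C^1 function, with the rate given by one integration by parts. *)
Lemma sin_integral_decay (g dg : R -> R) (a b : R) :
  a <= b ->
  (forall t, a <= t <= b -> is_derive g t (dg t)) ->
  (forall t, a <= t <= b -> continuous dg t) ->
  exists C, forall w I, 0 < w -> is_RInt (fun t => g t * sin (w * t)) a b I -> Rabs I <= C / w.
Proof.
  intros Hab Hg Hdg.
  destruct (continuity_ab_maj (fun t => Rabs (dg t)) a b Hab) as [c [Hc _]].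
  { intros t Ht. apply continuity_pt_filterlim.
    apply (continuous_comp dg Rabs); [now apply Hdg|apply continuous_Rabs]. }
  (* Two boundary terms, plus the interval length times the maximum of |dg|, attained at c. *)
  exists (Rabs (g a) + Rabs (g b) + (b - a) * Rabs (dg c)).
  intros w I Hw HI.
  assert (Hcos : forall x, Rabs (cos x) <= 1) by (intros; apply Rabs_le, COS_bound).
  assert (HJ : is_RInt (fun t => dg t * (- cos (w * t) / w)) a b
    (g b * (- cos (w * b) / w) - g a * (- cos (w * a) / w) - I)).
  { apply (is_RInt_scal_derive_l (V := R_CompleteNormedModule) g
      (fun t => - cos (w * t) / w) dg (fun t => sin (w * t)));
    rewrite ?Rmin_left, ?Rmax_right by exact Hab; try assumption.
    - intros t _. auto_derive; [easy|]. field. lra.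
    - intros t _. apply (ex_derive_continuous (fun t => sin (w * t))). now auto_derive. }
  assert (HB : Rabs (g b * (- cos (w * b) / w) - g a * (- cos (w * a) / w) - I)
    <= (b - a) * (Rabs (dg c) / w)).
  { apply (norm_RInt_le_const (V := R_NormedModule)
      (fun t => dg t * (- cos (w * t) / w)) a b _ (Rabs (dg c) / w) Hab); [|exact HJ].
    intros t Ht. change (Rabs (dg t * (- cos (w * t) / w)) <= Rabs (dg c) / w).
    unfold Rdiv. rewrite <- Rmult_assoc, Rabs_mult, (Rabs_right (/ w))
      by (apply Rle_ge, Rlt_le, Rinv_0_lt_compat, Hw).
    apply Rmult_le_compat_r; [apply Rlt_le, Rinv_0_lt_compat, Hw|].
    rewrite Rabs_mult, Rabs_Ropp.
    pose proof (Hc t Ht). pose proof (Hcos (w * t)). pose proof (Rabs_pos (dg t)).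
    pose proof (Rabs_pos (cos (w * t))). nra. }
  assert (HE : forall x, Rabs (g x * (- cos (w * x) / w)) <= Rabs (g x) / w).
  { intros x. unfold Rdiv. rewrite <- Rmult_assoc, Rabs_mult, (Rabs_right (/ w))
      by (apply Rle_ge, Rlt_le, Rinv_0_lt_compat, Hw).
    apply Rmult_le_compat_r; [apply Rlt_le, Rinv_0_lt_compat, Hw|].
    rewrite Rabs_mult, Rabs_Ropp.
    pose proof (Hcos (w * x)). pose proof (Rabs_pos (g x)). nra. }
  pose proof (HE a) as Ha. pose proof (HE b) as Hb.
  replace ((Rabs (g a) + Rabs (g b) + (b - a) * Rabs (dg c)) / w)
    with (Rabs (g a) / w + Rabs (g b) / w + (b - a) * (Rabs (dg c) / w)) by (field; lra).
  apply Rabs_le_between in Ha. apply Rabs_le_between in Hb. apply Rabs_le_between in HB.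
  apply Rabs_le_between. lra.
Qed.

Definition tanI (p : nat) : R :=
  RInt (fun t => PI * t ^ p * (sin (PI * t) / cos (PI * t))) 0 (1 / 4).

Lemma cos_PI_pos (t : R) : 0 <= t <= 1 / 4 -> 0 < cos (PI * t).
Proof. intros Ht. pose proof PI_RGT_0. apply cos_gt_0; nra. Qed.

Lemma is_RInt_tanI (p : nat) :
  is_RInt (fun t => PI * t ^ p * (sin (PI * t) / cos (PI * t))) 0 (1 / 4) (tanI p).
Proof.
  apply (RInt_correct (V := R_CompleteNormedModule)).
  apply (ex_RInt_continuous (V := R_CompleteNormedModule)).
  intros t Ht. rewrite Rmin_left, Rmax_right in Ht by lra.
  apply (ex_derive_continuous (fun t => PI * t ^ p * (sin (PI * t) / cos (PI * t)))).
  pose proof (cos_PI_pos t Ht). auto_derive. lra.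
Qed.

(** Multiplying by cos a turns each sine into a sum of two sines at neighbouring odd multiples of a,
    and the alternating sum telescopes. A pair starting at n = 2m+1 advances the multiple from 4m+1
    to 4m+5. *)
Lemma sin_pairs_sum (a : R) (M : nat) :
  cos a <> 0 ->
  sum_n (fun m => 2 * (sin (2 * INR (2 * m + 1) * a) - sin (2 * INR (2 * m + 2) * a))) M
  = sin a / cos a - sin (INR (4 * M + 5) * a) / cos a.
Proof.
  intros Ha.
  assert (P : forall n, 2 * (sin (2 * n * a) - sin (2 * (n + 1) * a))
            = sin ((2 * n - 1) * a) / cos a - sin ((2 * n + 3) * a) / cos a).
  { intros n. apply Rmult_eq_reg_r with (cos a); [|exact Ha].
    replace ((2 * n - 1) * a) with (2 * n * a - a) by ring.
    replace ((2 * n + 3) * a) with (2 * (n + 1) * a + a) by ring.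
    assert (Q : sin (2 * n * a + a) = sin (2 * (n + 1) * a - a)) by (f_equal; ring).
    rewrite sin_plus, sin_minus in Q. rewrite sin_plus, sin_minus.
    field_simplify; [|exact Ha]. lra. }
  induction M as [|M IH].
  - rewrite sum_O. simpl (INR (2 * 0 + 1)). simpl (INR (2 * 0 + 2)).
    specialize (P 1). rewrite P. eqR. simpl (INR _). do 3 f_equal; ring.
  - rewrite sum_n_succ, IH.
    replace (INR (2 * S M + 2)) with (INR (2 * S M + 1) + 1)
      by (rewrite !plus_INR; simpl; ring).
    rewrite P.
    replace (2 * INR (2 * S M + 1) - 1) with (INR (4 * M + 5))
      by (rewrite !plus_INR, !mult_INR, (S_INR M); simpl; ring).
    replace (2 * INR (2 * S M + 1) + 3) with (INR (4 * S M + 5))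
      by (rewrite !plus_INR, !mult_INR, (S_INR M); simpl; ring).
    eqR. ring.
Qed.

(** For w <> 0 this is the integral of t^p sin (w t) over [0, 1/4], as evaluated in
    [is_RInt_pow_sin]. *)
Definition sin_moment (p : nat) (w : R) : R :=
  INR (fact p) / w ^ S p * cos (INR p * (PI / 2))
     - sum_n (fun j => INR (fact p) / INR (fact (p - j)) / w ^ S j
               * (1 / 4) ^ (p - j) * cos (w * (1 / 4) + INR j * (PI / 2))) p.

(* The terms k = 2m+1 and k = 2m+2 are grouped, so that no parity case split is needed on k. *)
Lemma is_series_tanI_moments (p : nat) :
  is_series (fun m => 2 * PI * (sin_moment p (2 * PI * INR (2 * m + 1))
                                - sin_moment p (2 * PI * INR (2 * m + 2)))) (tanI p).
Proof.
  pose proof PI_RGT_0 as HPI.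
  set (q := fun m => 2 * PI * (sin_moment p (2 * PI * INR (2 * m + 1))
                                - sin_moment p (2 * PI * INR (2 * m + 2)))).
  (* The amplitude of the remainder in [sin_pairs_sum], weighted by pi t^p; it is smooth because the
     cosine stays positive on [0, 1/4]. *)
  destruct (sin_integral_decay (fun t => PI * t ^ p / cos (PI * t))
    (fun t => PI * (INR p * t ^ pred p) / cos (PI * t)
              + PI * t ^ p * (PI * sin (PI * t)) / cos (PI * t) ^ 2) 0 (1 / 4)) as [C HC].
  { lra. }
  { intros t Ht. pose proof (cos_PI_pos t Ht). auto_derive; [lra|]. field. lra. }
  { intros t Ht. pose proof (cos_PI_pos t Ht).
    apply (ex_derive_continuous (fun t => PI * (INR p * t ^ pred p) / cos (PI * t)
              + PI * t ^ p * (PI * sin (PI * t)) / cos (PI * t) ^ 2)).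
    auto_derive. split; [lra|split; [nra|easy]]. }
  assert (HI : forall M, is_RInt (fun t => PI * t ^ p / cos (PI * t)
      * sin (PI * INR (4 * M + 5) * t)) 0 (1 / 4) (tanI p - sum_n q M)).
  { intros M.
    apply (is_RInt_ext (fun t => minus (PI * t ^ p * (sin (PI * t) / cos (PI * t)))
      (sum_n (fun m => 2 * PI * (t ^ p * sin (2 * PI * INR (2 * m + 1) * t)
         - t ^ p * sin (2 * PI * INR (2 * m + 2) * t))) M))).
    - intros t Ht. rewrite Rmin_left, Rmax_right in Ht by lra.
      assert (Hc : cos (PI * t) <> 0).
      { apply Rgt_not_eq, cos_PI_pos; lra. }
      rewrite (sum_n_ext _ (fun m => PI * t ^ p * (2 * (sin (2 * INR (2 * m + 1) * (PI * t))
        - sin (2 * INR (2 * m + 2) * (PI * t)))))).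
      + rewrite sum_n_Rmult, (sin_pairs_sum _ _ Hc).
        match goal with |- minus ?a ?b = ?d => change (a - b = d) end.
        replace (PI * INR (4 * M + 5) * t) with (INR (4 * M + 5) * (PI * t)) by ring.
        field. exact Hc.
      + intros m. eqR.
        replace (2 * PI * INR (2 * m + 1) * t) with (2 * INR (2 * m + 1) * (PI * t)) by ring.
        replace (2 * PI * INR (2 * m + 2) * t) with (2 * INR (2 * m + 2) * (PI * t)) by ring.
        ring.
    - apply (is_RInt_minus (V := R_NormedModule)); [apply is_RInt_tanI|].
      apply is_RInt_sum_n. intros m.
      apply (is_RInt_scal (V := R_NormedModule)), (is_RInt_minus (V := R_NormedModule));
        apply is_RInt_pow_sin; apply Rmult_integral_contrapositive_currified; try lra;
        apply not_0_INR; lia. }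
  change (is_lim_seq (sum_n q) (tanI p)).
  apply is_lim_seq_ext with (fun M => tanI p - (tanI p - sum_n q M)); [intros; ring|].
  replace (Finite (tanI p)) with (Finite (tanI p - 0)) by (f_equal; ring).
  apply is_lim_seq_minus'; [apply is_lim_seq_const|].
  apply is_lim_seq_abs_0.
  apply is_lim_seq_le_le with (fun _ => 0) (fun M => Rabs C * / INR (S M)).
  - intros M. split; [apply Rabs_pos|].
    pose proof (lt_0_INR (S M) ltac:(lia)) as HM.
    assert (Hle : INR (S M) <= PI * INR (4 * M + 5)).
    { pose proof PI2_1. assert (INR (S M) <= INR (4 * M + 5)) by (apply le_INR; lia). nra. }
    eapply Rle_trans; [apply (HC (PI * INR (4 * M + 5)) _ ltac:(lra) (HI M))|].
    unfold Rdiv. pose proof (Rle_abs C).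
    apply Rle_trans with (Rabs C * / (PI * INR (4 * M + 5))).
    + apply Rmult_le_compat_r; [apply Rlt_le, Rinv_0_lt_compat; lra|easy].
    + apply Rmult_le_compat_l; [apply Rabs_pos|apply Rinv_le_contravar; lra].
  - apply is_lim_seq_const.
  - replace (Finite 0) with (Rbar_mult (Rabs C) 0) by (simpl; f_equal; ring).
    apply is_lim_seq_scal_l.
    apply is_lim_seq_inv_succ.
Qed.

Lemma cos_nat_PI (m : nat) (x : R) : cos (INR m * PI + x) = (-1) ^ m * cos x.
Proof.
  induction m as [|m IH].
  - simpl. rewrite Rmult_0_l, Rplus_0_l. ring.
  - rewrite S_INR. replace ((INR m + 1) * PI + x) with (INR m * PI + x + PI) by ring.
    rewrite neg_cos, IH. simpl. ring.
Qed.

(** At t = 1/4 the frequency 2 pi k gives the angle k pi/2. For k = 2m+1 this is m pi + pi/2, which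
    produces [beta] and raises the phase index to j+1; for k = 2m+2 it is (m+1) pi, which produces
    [zetaE] with the factor 2^-(j+1), its sign (-1)^(m+1) absorbing the minus of the pair. The
    endpoint 0 contributes the leading [zetaE (S p)]. *)
Lemma tanI_closed_form (p : nat) :
  tanI p = INR (fact p) / (2 * PI) ^ p * cos (INR p * (PI / 2)) * zetaE (S p)
    - sum_n (fun j => INR (fact p) / INR (fact (p - j)) / (2 * PI) ^ j * (1 / 4) ^ (p - j)
        * (cos (INR (S j) * (PI / 2)) * beta (S j)
           + cos (INR j * (PI / 2)) / 2 ^ S j * zetaE (S j))) p.
Proof.
  pose proof PI_RGT_0 as HPI.
  rewrite <- (is_series_unique _ _ (is_series_tanI_moments p)).
  apply is_series_unique.
  apply (is_series_ext (fun m =>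
    minus (INR (fact p) / (2 * PI) ^ p * cos (INR p * (PI / 2))
           * (/ INR (2 * m + 1) ^ S p - / INR (2 * m + 2) ^ S p))
     (sum_n (fun j => INR (fact p) / INR (fact (p - j)) / (2 * PI) ^ j * (1 / 4) ^ (p - j)
        * (cos (INR (S j) * (PI / 2)) * ((-1) ^ m / INR (2 * m + 1) ^ S j)
           + cos (INR j * (PI / 2)) / 2 ^ S j * ((-1) ^ m / INR (m + 1) ^ S j))) p))).
  - intros m.
    assert (H1 : INR (2 * m + 1) <> 0) by (apply not_0_INR; lia).
    assert (H2 : INR (2 * m + 2) <> 0) by (apply not_0_INR; lia).
    assert (H3 : INR (m + 1) <> 0) by (apply not_0_INR; lia).
    unfold sin_moment.
    rewrite (sum_n_ext (fun j => INR (fact p) / INR (fact (p - j)) / (2 * PI) ^ j * (1 / 4) ^ (p - j)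
        * (cos (INR (S j) * (PI / 2)) * ((-1) ^ m / INR (2 * m + 1) ^ S j)
           + cos (INR j * (PI / 2)) / 2 ^ S j * ((-1) ^ m / INR (m + 1) ^ S j)))
      (fun j => 2 * PI *
         (INR (fact p) / INR (fact (p - j)) / (2 * PI * INR (2 * m + 1)) ^ S j
               * (1 / 4) ^ (p - j) * cos (2 * PI * INR (2 * m + 1) * (1 / 4) + INR j * (PI / 2)))
        - 2 * PI *
         (INR (fact p) / INR (fact (p - j)) / (2 * PI * INR (2 * m + 2)) ^ S j
               * (1 / 4) ^ (p - j) * cos (2 * PI * INR (2 * m + 2) * (1 / 4) + INR j * (PI / 2))))).
    + rewrite sum_n_scal_minus.
      match goal with |- minus ?a ?b = ?d => change (a - b = d) end.
      rewrite !Rpow_mult_distr. simpl pow.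
      field.
      repeat split; try apply pow_nonzero; try assumption; lra.
    + intros j. eqR.
      replace (2 * PI * INR (2 * m + 1) * (1 / 4) + INR j * (PI / 2))
        with (INR m * PI + INR (S j) * (PI / 2))
        by (rewrite plus_INR, mult_INR, S_INR; simpl; field).
      replace (2 * PI * INR (2 * m + 2) * (1 / 4) + INR j * (PI / 2))
        with (INR (S m) * PI + INR j * (PI / 2))
        by (rewrite plus_INR, mult_INR, S_INR; simpl; field).
      rewrite !cos_nat_PI.
      replace (INR (2 * m + 2)) with (2 * INR (m + 1)) by (rewrite !plus_INR, mult_INR; simpl; ring).
      rewrite !Rpow_mult_distr.
      change ((-1) ^ S m) with (-1 * (-1) ^ m).
      set (x := cos _). set (y := cos _). simpl pow.
      field.
      repeat split; try apply pow_nonzero; try apply INR_fact_neq_0; try assumption; lra.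
  - apply (is_series_minus (V := R_NormedModule)).
    + apply is_series_Rmult, is_series_zetaE_pairs. lia.
    + apply is_series_sum_n. intros j.
      apply is_series_Rmult, (is_series_plus (V := R_NormedModule));
        apply is_series_Rmult.
      * apply is_series_beta; lia.
      * apply is_series_zetaE; lia.
Qed.

(** * The multiple cosine function at 1/4 *)

(** The polynomial has derivative 1 + y + ... + y^(r-1), which cancels all but the tail of the
    geometric series -1/(1-y). *)
Lemma is_derive_LogP (r : nat) (y : R) :
  y < 1 -> is_derive (LogP r) y (- y ^ r / (1 - y)).
Proof.
  intros Hy. unfold LogP. induction r as [|r IH].
  - apply is_derive_ext with (fun y => ln (1 - y)).
    + intros t. rewrite sum_n_m_zero by lia. change zero with 0. eqR. ring.
    + auto_derive; [lra|]. simpl. field. lra.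
  - apply is_derive_ext with (fun y => (ln (1 - y) + sum_n_m (fun j => y ^ j / INR j) 1 r)
                                       + y ^ S r / INR (S r)).
    + intros t. rewrite (sum_n_Sm _ 1 r) by lia.
      change (plus ?a ?b) with (Rplus a b). eqR. ring.
    + assert (HS : INR (S r) <> 0) by (apply not_0_INR; lia).
      evar_last.
      * apply (is_derive_plus (V := R_NormedModule)); [exact IH|].
        instantiate (1 := y ^ r). auto_derive; [easy|]. change (pred (S r)) with r. field. exact HS.
      * change (plus ?a ?b) with (Rplus a b). simpl. field. lra.
Qed.

Lemma LogP_0 (r : nat) : LogP r 0 = 0.
Proof.
  unfold LogP. rewrite Rminus_0_r, ln_1, Rplus_0_l.
  induction r as [|r IH].
  - now rewrite sum_n_m_zero by lia.
  - rewrite (sum_n_Sm _ 1 r) by lia. rewrite IH.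
    change (plus ?a ?b) with (Rplus a b). rewrite pow_i by lia. eqR. unfold Rdiv. ring.
Qed.

Definition logC_term (r : nat) (x : R) (m : nat) : R :=
  (INR (2 * m + 1) / 2) ^ (r - 1) *
    (LogP r (2 * x / INR (2 * m + 1)) + (-1) ^ (r - 1) * LogP r (- (2 * x) / INR (2 * m + 1))).

(** With y = 2x/n, the weight (n/2)^p turns y^p into x^p. The sign (-1)^p of the definition meets
    the one from (-y)^p, so for either parity the bracket is -1/(1-y) - 1/(1+y) = -2/(1-y^2). *)
Lemma is_derive_logC_term (p m : nat) (x : R) :
  Rabs x < 1 / 2 ->
  is_derive (fun x => logC_term (S p) x m) x
    (- (x ^ p * (8 * x / (INR (2 * m + 1) ^ 2 - 4 * x ^ 2)))).
Proof.
  intros Hx. unfold logC_term. replace (S p - 1)%nat with p by lia.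
  set (n := INR (2 * m + 1)).
  assert (Hn : 1 <= n) by (apply (le_INR 1); lia).
  apply Rabs_lt_between in Hx.
  assert (H1 : 2 * x / n < 1).
  { apply Rmult_lt_reg_r with n; [lra|]. unfold Rdiv. rewrite Rmult_assoc, Rinv_l; lra. }
  assert (H2 : - (2 * x) / n < 1).
  { apply Rmult_lt_reg_r with n; [lra|]. unfold Rdiv. rewrite Rmult_assoc, Rinv_l; lra. }
  assert (D1 : is_derive (fun x => LogP (S p) (2 * x / n)) x
     (2 / n * (- (2 * x / n) ^ S p / (1 - 2 * x / n)))).
  { apply (is_derive_comp (V := R_NormedModule) (LogP (S p)) (fun x => 2 * x / n)).
    - now apply is_derive_LogP.
    - auto_derive; [easy|]. field. lra. }
  assert (D2 : is_derive (fun x => LogP (S p) (- (2 * x) / n)) x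
     (- 2 / n * (- (- (2 * x) / n) ^ S p / (1 - - (2 * x) / n)))).
  { apply (is_derive_comp (V := R_NormedModule) (LogP (S p)) (fun x => - (2 * x) / n)).
    - now apply is_derive_LogP.
    - auto_derive; [easy|]. field. lra. }
  evar_last.
  - apply is_derive_scal, (is_derive_plus (V := R_NormedModule)); [exact D1|].
    apply is_derive_scal, D2.
  - change (plus ?a ?b) with (Rplus a b).
    replace (- (2 * x) / n) with (-1 * (2 * x / n)) by (field; lra).
    rewrite !Rpow_mult_distr.
    assert (Hp : (-1) ^ p * (-1) ^ p = 1) by (rewrite <- Rpow_mult_distr; replace (-1 * -1) with 1 by ring; apply pow1).
    assert (HA : (n / 2) ^ p * (2 * x / n) ^ p = x ^ p)
      by (rewrite <- Rpow_mult_distr; f_equal; field; lra).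
    rewrite <- HA. simpl pow.
    set (A := (n / 2) ^ p) in *. set (s := (-1) ^ p) in *. set (Y := (2 * x / n) ^ p) in *.
    transitivity (A * Y * (2 * x / n) * (2 / n)
                  * (- / (1 - 2 * x / n) - s * s / (1 + 2 * x / n))).
    + field. lra.
    + rewrite Hp. field. repeat split; nra.
Qed.

Definition ln_cos_error (m : nat) (x : R) : R := ln (cos (PI * x)) - ln_cos_prod m x.

Lemma is_derive_ln_cos_error (m : nat) (x : R) :
  0 <= x <= 1 / 4 ->
  is_derive (ln_cos_error m) x
    (sum_n (fun k => 8 * x / (INR (2 * k + 1) ^ 2 - 4 * x ^ 2)) m
     - PI * (sin (PI * x) / cos (PI * x))).
Proof.
  intros Hx. pose proof (cos_PI_pos x Hx).
  evar_last.
  - apply (is_derive_minus (V := R_NormedModule)).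
    + instantiate (1 := - (PI * (sin (PI * x) / cos (PI * x)))).
      auto_derive; [lra|]. field. lra.
    + unfold ln_cos_prod. apply (is_derive_sum_n (V := R_NormedModule)). intros k _.
      instantiate (1 := fun k => -1 * (8 * x / (INR (2 * k + 1) ^ 2 - 4 * x ^ 2))).
      assert (Hk : 1 <= INR (2 * k + 1)) by (apply (le_INR 1); lia).
      assert (P : 0 < 1 - 4 * x ^ 2 / INR (2 * k + 1) ^ 2)
        by (apply odd_factor_pos; rewrite Rabs_right; lra).
      set (n := INR (2 * k + 1)) in *.
      auto_derive; [repeat split; simpl in *; lra|].
      fold n. field. repeat split; try nra.
  - match goal with |- minus ?a ?b = _ => change (minus a b) with (a - b) end.
    rewrite sum_n_Rmult. ring.
Qed.

(** Integration by parts against x^p, with the uniform bound [ln_cos_prod_bound] on the error. In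
    the constant, [INR p] bounds the remaining integral and 1 bounds the boundary term at 1/4. *)
Lemma logC_partial_sum_bound (p m : nat) :
  Rabs (sum_n (logC_term (S p) (1 / 4)) (S m) + tanI p) <= (INR p + 1) * / INR (S m).
Proof.
  set (L := ln_cos_error (S m)).
  assert (Hm : 0 < / INR (S m)) by (apply Rinv_0_lt_compat, lt_0_INR; lia).
  assert (Hb : forall x, 0 <= x <= 1 / 4 -> Rabs (L x) <= / INR (S m)).
  { intros x Hx. apply ln_cos_prod_bound. rewrite Rabs_right; lra. }
  (* G' = p x^(p-1) L - pi x^p tan (pi x), so only the size of L, not of L', matters. *)
  pose (G := fun x => sum_n (logC_term (S p) x) (S m) + x ^ p * L x).
  assert (DG : forall x, 0 <= x <= 1 / 4 -> is_derive G x
     (INR p * x ^ pred p * L x - PI * x ^ p * (sin (PI * x) / cos (PI * x)))).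
  { intros x Hx. unfold G. evar_last.
    - apply (is_derive_plus (V := R_NormedModule)).
      + apply (is_derive_sum_n (V := R_NormedModule) (fun k x => logC_term (S p) x k)).
        intros k _. apply is_derive_logC_term. rewrite Rabs_right; lra.
      + apply (is_derive_mult (fun x => x ^ p) L).
        * instantiate (1 := INR p * x ^ pred p). auto_derive; [easy|ring].
        * now apply is_derive_ln_cos_error.
        * intros; apply Rmult_comm.
    - rewrite (sum_n_ext _ (fun k => - x ^ p * (8 * x / (INR (2 * k + 1) ^ 2 - 4 * x ^ 2))))
        by (intros k; eqR; ring).
      rewrite sum_n_Rmult.
      match goal with |- plus ?a (plus (mult ?b ?c) (mult ?d ?e)) = ?f =>
        change (a + (b * c + d * e) = f) end.
      ring. }
  assert (DL : forall x, 0 <= x <= 1 / 4 -> ex_derive L x)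
    by (intros x Hx; eexists; now apply is_derive_ln_cos_error).
  assert (HG : is_RInt (fun x => INR p * x ^ pred p * L x
       - PI * x ^ p * (sin (PI * x) / cos (PI * x))) 0 (1 / 4) (G (1 / 4) - G 0)).
  { apply is_RInt_derivative; intros x Hx; rewrite Rmin_left, Rmax_right in Hx by lra.
    - now apply DG.
    - pose proof (cos_PI_pos x Hx). specialize (DL x Hx). auto_derive. repeat split; try easy; lra. }
  assert (G0 : G 0 = 0).
  { unfold G.
    assert (S0 : forall k, sum_n (logC_term (S p) 0) k = 0).
    { assert (T0 : forall k, logC_term (S p) 0 k = 0).
      { intros k. unfold logC_term. rewrite Rmult_0_r, Ropp_0. unfold Rdiv at 2 3.
        rewrite !Rmult_0_l, LogP_0. ring. }
      intros k. rewrite (sum_n_ext _ (fun _ => 0)) by exact T0.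
      rewrite sum_n_const. eqR. ring. }
    assert (L0 : L 0 = 0).
    { unfold L, ln_cos_error, ln_cos_prod. rewrite Rmult_0_r, cos_0, ln_1.
      rewrite (sum_n_ext _ (fun _ => 0)).
      - rewrite sum_n_const. ring.
      - intros k. replace (1 - 4 * 0 ^ 2 / INR (2 * k + 1) ^ 2) with 1 by (unfold Rdiv; ring).
        apply ln_1. }
    rewrite S0, L0. ring. }
  assert (HJ : is_RInt (fun x => INR p * x ^ pred p * L x) 0 (1 / 4) (G (1 / 4) + tanI p)).
  { rewrite G0, Rminus_0_r in HG.
    eapply is_RInt_ext; [|apply (is_RInt_plus (V := R_NormedModule) _ _ _ _ _ _ HG (is_RInt_tanI p))].
    intros x _. change (plus ?a ?b) with (Rplus a b). simpl. ring. }
  assert (P1 : forall x k, 0 <= x <= 1 / 4 -> 0 <= x ^ k <= 1).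
  { intros x k Hx. split; [apply pow_le; lra|]. rewrite <- (pow1 k). apply pow_incr; lra. }
  assert (BJ : Rabs (G (1 / 4) + tanI p) <= (1 / 4 - 0) * (INR p * / INR (S m))).
  { apply (norm_RInt_le_const (V := R_NormedModule) (fun x => INR p * x ^ pred p * L x) 0 (1 / 4));
      [lra| |exact HJ].
    intros x Hx. change (Rabs (INR p * x ^ pred p * L x) <= INR p * / INR (S m)).
    specialize (Hb x Hx). destruct (P1 x (pred p) Hx).
    rewrite Rmult_assoc, Rabs_mult, (Rabs_right (INR p)) by apply Rle_ge, pos_INR.
    apply Rmult_le_compat_l; [apply pos_INR|].
    rewrite Rabs_mult, (Rabs_right (x ^ _)) by lra.
    pose proof (Rabs_pos (L x)). nra. }
  assert (BL : Rabs ((1 / 4) ^ p * L (1 / 4)) <= / INR (S m)).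
  { specialize (Hb (1 / 4) ltac:(lra)). destruct (P1 (1 / 4) p ltac:(lra)).
    rewrite Rabs_mult, (Rabs_right (_ ^ _)) by lra.
    pose proof (Rabs_pos (L (1 / 4))). nra. }
  unfold G in BJ. pose proof (pos_INR p).
  assert (0 <= INR p * / INR (S m)) by nra.
  apply Rabs_le_between in BJ. apply Rabs_le_between in BL. apply Rabs_le_between.
  lra.
Qed.

Lemma logC_tanI (p : nat) : logC (S p) (1 / 4) = - tanI p.
Proof.
  apply is_series_unique. change (is_lim_seq (sum_n (logC_term (S p) (1 / 4))) (- tanI p)).
  (* The bound concerns partial sums ending at [S m], hence the shift. *)
  apply is_lim_seq_incr_1.
  apply is_lim_seq_ext with
    (fun m => - tanI p + (sum_n (logC_term (S p) (1 / 4)) (S m) + tanI p)); [intros; ring|].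
  replace (Finite (- tanI p)) with (Finite (- tanI p + 0)) by (f_equal; ring).
  apply is_lim_seq_plus'; [apply is_lim_seq_const|].
  apply is_lim_seq_abs_0.
  apply is_lim_seq_le_le with (fun _ => 0) (fun m => (INR p + 1) * / INR (S m)).
  - intros m. split; [apply Rabs_pos|apply logC_partial_sum_bound].
  - apply is_lim_seq_const.
  - replace (Finite 0) with (Rbar_mult (INR p + 1) 0) by (simpl; f_equal; ring).
    apply is_lim_seq_scal_l.
    apply is_lim_seq_inv_succ.
Qed.

(** * The value zeta_E(1) and the final evaluation *)

Lemma tanI_0 : tanI 0 = ln 2 / 2.
Proof.
  apply (is_RInt_unique (V := R_CompleteNormedModule)).
  assert (E : ln 2 / 2 = - ln (cos (PI * (1 / 4))) - - ln (cos (PI * 0))).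
  { rewrite Rmult_0_r, cos_0, ln_1. replace (PI * (1 / 4)) with (PI / 4) by field.
    rewrite cos_PI4. unfold Rdiv at 2. rewrite Rmult_1_l, ln_Rinv by apply Rlt_sqrt2_0.
    rewrite <- (sqrt_sqrt 2) at 1 by lra. rewrite ln_mult by apply Rlt_sqrt2_0. field. }
  rewrite E. apply (is_RInt_derivative (fun t => - ln (cos (PI * t))));
    intros t Ht; rewrite Rmin_left, Rmax_right in Ht by lra; pose proof (cos_PI_pos t Ht).
  - auto_derive; [lra|]. field. lra.
  - auto_derive. lra.
Qed.

(** At p = 0 the closed form reads [tanI 0] = zeta_E(1) - zeta_E(1)/2, since the coefficient cos
    (pi/2) removes [beta]. *)
Lemma zetaE_1 : zetaE 1 = ln 2.
Proof.
  pose proof (tanI_closed_form 0) as H. rewrite tanI_0, sum_O in H.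
  simpl in H. rewrite Rmult_1_l, cos_PI2, Rmult_0_l, cos_0 in H. lra.
Qed.

(** With p = r - 2, this extracts the prefactor r - 1 and the binomials of the theorem from the
    coefficient of index j+1 in the closed form at exponent r - 1. *)
Lemma fact_quot (p j : nat) :
  (j <= p)%nat ->
  INR (fact (S p)) / INR (fact (p - j)) = INR (S p) * (INR (fact j) * Binomial.C p j).
Proof.
  intros Hj. unfold Binomial.C. rewrite fact_simpl, mult_INR. field.
  split; apply INR_fact_neq_0.
Qed.

Lemma cos_half_turns (k : nat) : cos (INR (2 * k) * (PI / 2)) = (-1) ^ k.
Proof.
  replace (INR (2 * k) * (PI / 2)) with (INR k * PI + 0) by (rewrite mult_INR; simpl; field).
  rewrite cos_nat_PI, cos_0. ring.
Qed.

Lemma cos_odd_quarter_turns (k : nat) : cos (INR (2 * k + 1) * (PI / 2)) = 0.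
Proof.
  replace (INR (2 * k + 1) * (PI / 2)) with (INR k * PI + PI / 2)
    by (rewrite plus_INR, mult_INR; simpl; field).
  rewrite cos_nat_PI, cos_PI2. ring.
Qed.

Theorem theorem2p4 (r : nat) (hr : (2 <= r)%nat) :
  logC r (1 / 4) =
    ln 2 / 2 ^ (2 * r - 1)
    - INR (Factorial.fact (r - 1)) / (2 * PI) ^ (r - 1) * sin (INR r * PI / 2) * zetaE r
    - INR (r - 1) / 2 ^ (2 * (r - 1)) *
        sum_n_m (fun k => (-1) ^ k * INR (Factorial.fact (2 * k)) * Binomial.C (r - 2) (2 * k)
                          * (2 / PI) ^ (2 * k + 1) * beta (2 * k + 2))
                0 ((r - 2) / 2)
    - INR (r - 1) / 2 ^ (2 * r - 1) *
        sum_n_m (fun k => (-1) ^ (k - 1) * INR (Factorial.fact (2 * k - 1)) / PI ^ (2 * k)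
                          * Binomial.C (r - 2) (2 * k - 1) * zetaE (2 * k + 1))
                1 ((r - 1) / 2).
Proof.
  destruct r as [|[|p]]; [lia|lia|]. clear hr.
  replace (S (S p) - 2)%nat with p by lia. replace (S (S p) - 1)%nat with (S p) by lia.
  replace (2 * S (S p) - 1)%nat with (S (2 * S p)) by lia.
  rewrite logC_tanI, tanI_closed_form, sum_n_parity_split.
  pose proof PI_RGT_0 as HPI.
  assert (Hpow : forall n, (1 / 4) ^ n = / 2 ^ (2 * n)).
  { intros n. rewrite pow_mult, <- pow_inv. f_equal. field. }
  assert (Hsin : sin (INR (S (S p)) * PI / 2) = cos (INR (S p) * (PI / 2))).
  { rewrite cos_sin. f_equal. rewrite (S_INR (S p)). field. }
  rewrite Hsin.
  (* Odd index 2k+1: the [zetaE] part has coefficient 0, and cos ((k+1) pi) = (-1)^(k+1) supplies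
     the minus sign. *)
  rewrite (sum_n_m_ext_loc _ (fun k => - (INR (S p) / 2 ^ (2 * S p)) *
     ((-1) ^ k * INR (fact (2 * k)) * Binomial.C p (2 * k)
                          * (2 / PI) ^ (2 * k + 1) * beta (2 * k + 2))) 0 (p / 2)).
  2: { intros k [_ Hk]. assert (Hk' : (2 * k <= p)%nat) by (pose proof (Nat.Div0.mul_div_le p 2); lia).
    rewrite cos_odd_quarter_turns.
    replace (S p - (2 * k + 1))%nat with (p - 2 * k)%nat by lia.
    rewrite fact_quot by lia.
    replace (S (2 * k + 1)) with (2 * S k)%nat by lia. rewrite cos_half_turns.
    replace (2 * S k)%nat with (2 * k + 2)%nat by lia.
    rewrite Hpow.
    (* The exponent is split to match the powers of 2 in (1/4)^(p-2k), (2 pi)^(2k+1) and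
       (2/pi)^(2k+1). *)
    replace (2 * S p)%nat with (2 * (p - 2 * k) + (2 * k + 1) + (2 * k + 1))%nat by lia.
    rewrite (pow_add _ (_ + _)), (pow_add _ (2 * (p - 2 * k))).
    replace ((2 / PI) ^ (2 * k + 1)) with (2 ^ (2 * k + 1) / PI ^ (2 * k + 1))
      by (unfold Rdiv; now rewrite Rpow_mult_distr, pow_inv).
    rewrite Rpow_mult_distr. change ((-1) ^ S k) with (-1 * (-1) ^ k). eqR.
    field. repeat split; try apply pow_nonzero; lra. }
  (* Even index 2k >= 2: now the [beta] part has coefficient 0, and 2^(2k+1) beside [zetaE] accounts
     for the additional factor 1/2. *)
  rewrite (sum_n_m_ext_loc _ (fun k => - (INR (S p) / 2 ^ S (2 * S p)) *
     ((-1) ^ (k - 1) * INR (fact (2 * k - 1)) / PI ^ (2 * k)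
                          * Binomial.C p (2 * k - 1) * zetaE (2 * k + 1))) 1 (S p / 2)).
  2: { intros k [Hk1 Hk].
    assert (Hk' : (2 * k <= S p)%nat) by (pose proof (Nat.Div0.mul_div_le (S p) 2); lia).
    replace (S (2 * k)) with (2 * k + 1)%nat by lia.
    rewrite cos_odd_quarter_turns, cos_half_turns.
    replace (S p - 2 * k)%nat with (p - (2 * k - 1))%nat by lia.
    rewrite fact_quot, Hpow by lia.
    replace (2 * S p)%nat with (2 * (p - (2 * k - 1)) + 2 * k + 2 * k)%nat by lia.
    change (2 ^ S ?n) with (2 * 2 ^ n). rewrite !pow_add, Rpow_mult_distr, pow_1.
    replace ((-1) ^ k) with (-1 * (-1) ^ (k - 1)).
    2: { replace k with (S (k - 1)) at 2 by lia. reflexivity. }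
    eqR. field. repeat split; try apply pow_nonzero; lra. }
  rewrite !sum_n_m_Rmult.
  (* Index 0 leaves (1/4)^(r-1) zeta_E(1)/2, which is the term ln 2 / 2^(2r-1). *)
  replace (INR (fact (S p)) / INR (fact (S p - 0))) with 1
    by (rewrite Nat.sub_0_r; field; apply INR_fact_neq_0).
  rewrite Nat.sub_0_r, Hpow, zetaE_1.
  change (INR 0) with 0. change (INR 1) with 1. rewrite Rmult_0_l, Rmult_1_l, cos_0, cos_PI2.
  change (2 ^ S (2 * S p)) with (2 * 2 ^ (2 * S p)).
  rewrite pow_O, pow_1.
  field. repeat split; try apply pow_nonzero; lra.
Qed.
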